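(* Let $n\ge 2$ be an integer, let $(\mathcal{A},\mathcal{E})$ be a Frobenius exact category, let $T\colon\mathcal{A}\to\mathcal{A}$ be an additive autoequivalence, and let $\omega\colon\mathrm{Id}_{\mathcal{A}}\to T$ be a natural transformation with $\omega_{T(X)}=T(\omega_X)$ for every object $X\in\mathcal{A}$. Then $(\mathrm{Fact}_n(\mathcal{A},T,\omega),\tilde{\mathcal{E}})$ is a Frobenius exact category.
   Context: **Factorizations.** An $n$-fold $(\mathcal{A},T)$-factorization $X=(X^j,d_X^j)$ of $\omega$ is a sequence $X^0\xrightarrow{d_X^0}X^1\xrightarrow{d_X^1}\cdots\xrightarrow{d_X^{n-2}}X^{n-1}\xrightarrow{d_X^{n-1}}T(X^0)$ in $\mathcal{A}$ such that $d_X^{n-1}\circ\cdots\circ d_X^0=\omega_{X^0}$, and $T(d_X^{j-1})\circ\cdots\circ T(d_X^0)\circ d_X^{n-1}\circ\cdots\circ d_X^{j}=\omega_{X^j}$ for $1\le j\le n-1$. A morphism $f\colon X\to Y$ is a sequence $(f^0,\dots,f^{n-1})$ of morphisms $f^j\colon X^j\to Y^j$ in $\mathcal{A}$ with $f^{j+1}d_X^j=d_Y^jf^j$ for $0\le j\le n-2$ and $T(f^0)d_X^{n-1}=d_Y^{n-1}f^{n-1}$. With componentwise composition and addition these form the additive category $\mathrm{Fact}_n(\mathcal{A},T,\omega)$. **Exact structures.** Exact categories are in the sense of Quillen: a class $\mathcal{E}$ of kernel-cokernel pairs (conflations), closed under isomorphism, satisfying Quillen's axioms; the first morphism of a conflation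 is an inflation, the second a deflation. An exact category is Frobenius if it has enough projectives and enough injectives (relative to its conflations) and the projective objects coincide with the injective objects. $\tilde{\mathcal{E}}$ is the class of composable pairs $(l,p)$ of morphisms in $\mathrm{Fact}_n(\mathcal{A},T,\omega)$ such that $(l^j,p^j)\in\mathcal{E}$ for all $0\le j\le n-1$.
   Formalization: The autoequivalence T is additionally assumed to preserve and reflect conflations (a pair lies in E if and only if its image under T does); for a merely additive autoequivalence the claim is false. *)

(* Defs.v *)
From HB Require Import structures.
From mathcomp Require Import all_boot all_order all_algebra.
From mathcomp Require Import boolp.

Set Implicit Arguments.
Unset Strict Implicit.
Unset Printing Implicit Defensive.

Import GRing.Theory.
Local Open Scope ring_scope.

Declare Scope cat_scope.
Delimit Scope cat_scope with cat.
Reserved Notation "g ∘ f" (at level 40, left associativity).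

Record preaddCat := PreaddCat {
  ob :> Type;
  hom : ob -> ob -> zmodType;
  idm : forall x : ob, hom x x;
  comp : forall x y z : ob, hom y z -> hom x y -> hom x z;
  comp_idl : forall (x y : ob) (f : hom x y), comp (idm y) f = f;
  comp_idr : forall (x y : ob) (f : hom x y), comp f (idm x) = f;
  compA : forall (x y z t : ob) (h : hom z t) (g : hom y z) (f : hom x y),
    comp h (comp g f) = comp (comp h g) f;
  compDl : forall (x y z : ob) (g g' : hom y z) (f : hom x y),
    comp (g + g') f = comp g f + comp g' f;
  compDr : forall (x y z : ob) (g : hom y z) (f f' : hom x y),
    comp g (f + f') = comp g f + comp g f'
}.

Notation "g ∘ f" := (comp g f) : cat_scope.
Local Open Scope cat_scope.

Definition is_iso (C : preaddCat) (x y : C) (f : hom x y) : Prop :=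
  exists g : hom y x, g ∘ f = idm x /\ f ∘ g = idm y.

Definition is_additive (C : preaddCat) : Prop :=
  (exists z : C, idm z = 0) /\
  (forall x y : C, exists (s : C)
     (i1 : hom x s) (i2 : hom y s) (p1 : hom s x) (p2 : hom s y),
     [/\ p1 ∘ i1 = idm x, p2 ∘ i2 = idm y, p1 ∘ i2 = 0, p2 ∘ i1 = 0
       & i1 ∘ p1 + i2 ∘ p2 = idm s]).

Record addFunctor (C D : preaddCat) := AddFunctor {
  fobj :> C -> D;
  fmor : forall x y : C, hom x y -> hom (fobj x) (fobj y);
  fmor_id : forall x : C, fmor (idm x) = idm (fobj x);
  fmor_comp : forall (x y z : C) (g : hom y z) (f : hom x y),
    fmor (g ∘ f) = fmor g ∘ fmor f;
  fmorD : forall (x y : C) (f g : hom x y), fmor (f + g) = fmor f + fmor g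
}.

Arguments fmor {C D} _ {x y} _.

Definition idFunctor (C : preaddCat) : addFunctor C C :=
  @AddFunctor C C (fun x => x) (fun _ _ f => f)
    (fun _ => erefl) (fun _ _ _ _ _ => erefl) (fun _ _ _ _ => erefl).

Lemma compFunctor_id (C D E : preaddCat) (G : addFunctor D E)
    (F : addFunctor C D) (x : C) : fmor G (fmor F (idm x)) = idm (G (F x)).
Proof. by rewrite !fmor_id. Qed.

Lemma compFunctor_comp (C D E : preaddCat) (G : addFunctor D E)
    (F : addFunctor C D) (x y z : C) (g : hom y z) (f : hom x y) :
  fmor G (fmor F (g ∘ f)) = fmor G (fmor F g) ∘ fmor G (fmor F f).
Proof. by rewrite !fmor_comp. Qed.

Lemma compFunctorD (C D E : preaddCat) (G : addFunctor D E)
    (F : addFunctor C D) (x y : C) (f g : hom x y) :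
  fmor G (fmor F (f + g)) = fmor G (fmor F f) + fmor G (fmor F g).
Proof. by rewrite !fmorD. Qed.

Definition compFunctor (C D E : preaddCat) (G : addFunctor D E)
    (F : addFunctor C D) : addFunctor C E :=
  AddFunctor (@compFunctor_id C D E G F) (@compFunctor_comp C D E G F)
    (@compFunctorD C D E G F).

Record natTrans (C D : preaddCat) (F G : addFunctor C D) := NatTrans {
  ncomp :> forall x : C, hom (F x) (G x);
  natural : forall (x y : C) (f : hom x y),
    ncomp y ∘ fmor F f = fmor G f ∘ ncomp x
}.

Definition nat_isomorphic (C D : preaddCat) (F G : addFunctor C D) : Prop :=
  exists a : natTrans F G, forall x : C, is_iso (a x).

(* A quasi-inverse of an additive functor is automatically additive. *)
Definition is_equivalence (C D : preaddCat) (F : addFunctor C D) : Prop :=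
  exists G : addFunctor D C,
    nat_isomorphic (compFunctor G F) (idFunctor C) /\
    nat_isomorphic (compFunctor F G) (idFunctor D).

Section Exact.
Variable C : preaddCat.

Definition is_kernel (x y z : C) (l : hom x y) (p : hom y z) : Prop :=
  p ∘ l = 0 /\
  forall (t : C) (f : hom t y), p ∘ f = 0 -> exists! g : hom t x, l ∘ g = f.

Definition is_cokernel (x y z : C) (l : hom x y) (p : hom y z) : Prop :=
  p ∘ l = 0 /\
  forall (t : C) (f : hom y t), f ∘ l = 0 -> exists! g : hom z t, g ∘ p = f.

(*   x --i--> y
     |f       |f'
     x' -i'-> y'   *)
Definition is_pushout (x y x' y' : C) (i : hom x y) (f : hom x x')
    (i' : hom x' y') (f' : hom y y') : Prop :=
  i' ∘ f = f' ∘ i /\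
  forall (t : C) (u : hom x' t) (v : hom y t), u ∘ f = v ∘ i ->
    exists! h : hom y' t, h ∘ i' = u /\ h ∘ f' = v.

(*   y' -p'-> z'
     |f'      |f
     y --p--> z   *)
Definition is_pullback (y z y' z' : C) (p : hom y z) (f : hom z' z)
    (p' : hom y' z') (f' : hom y' y) : Prop :=
  f ∘ p' = p ∘ f' /\
  forall (t : C) (u : hom t z') (v : hom t y), f ∘ u = p ∘ v ->
    exists! h : hom t y', p' ∘ h = u /\ f' ∘ h = v.

Definition pair_class := forall x y z : C, hom x y -> hom y z -> Prop.

Variable E : pair_class.

Definition inflation (x y : C) (l : hom x y) : Prop :=
  exists (z : C) (p : hom y z), E l p.

Definition deflation (y z : C) (p : hom y z) : Prop :=
  exists (x : C) (l : hom x y), E l p.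

Definition iso_closed : Prop :=
  forall (x y z x' y' z' : C) (l : hom x y) (p : hom y z)
    (l' : hom x' y') (p' : hom y' z')
    (a : hom x x') (b : hom y y') (c : hom z z'),
    is_iso a -> is_iso b -> is_iso c ->
    b ∘ l = l' ∘ a -> c ∘ p = p' ∘ b -> E l p -> E l' p'.

(* Quillen's axioms in the self-dual form of Keller and Buehler; Quillen's
   "obscure" axiom is a consequence of these. *)
Record is_exact : Prop := IsExact {
  exact_additive : is_additive C;
  exact_kernel : forall (x y z : C) (l : hom x y) (p : hom y z),
    E l p -> is_kernel l p;
  exact_cokernel : forall (x y z : C) (l : hom x y) (p : hom y z),
    E l p -> is_cokernel l p;
  exact_iso : iso_closed;
  inflation_id : forall x : C, inflation (idm x);
  deflation_id : forall x : C, deflation (idm x);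
  inflation_comp : forall (x y z : C) (f : hom x y) (g : hom y z),
    inflation f -> inflation g -> inflation (g ∘ f);
  deflation_comp : forall (x y z : C) (f : hom x y) (g : hom y z),
    deflation f -> deflation g -> deflation (g ∘ f);
  inflation_pushout : forall (x y x' : C) (i : hom x y) (f : hom x x'),
    inflation i ->
    exists (y' : C) (i' : hom x' y') (f' : hom y y'),
      is_pushout i f i' f' /\ inflation i';
  deflation_pullback : forall (y z z' : C) (p : hom y z) (f : hom z' z),
    deflation p ->
    exists (y' : C) (p' : hom y' z') (f' : hom y' y),
      is_pullback p f p' f' /\ deflation p'
}.

Definition projective (q : C) : Prop :=
  forall (y z : C) (p : hom y z) (f : hom q z), deflation p ->
    exists g : hom q y, p ∘ g = f.

Definition injective_ob (q : C) : Prop :=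
  forall (x y : C) (l : hom x y) (f : hom x q), inflation l ->
    exists g : hom y q, g ∘ l = f.

Definition enough_projectives : Prop :=
  forall x : C, exists (q : C) (p : hom q x), projective q /\ deflation p.

Definition enough_injectives : Prop :=
  forall x : C, exists (q : C) (l : hom x q), injective_ob q /\ inflation l.

Definition is_Frobenius : Prop :=
  [/\ is_exact, enough_projectives, enough_injectives
    & forall q : C, projective q <-> injective_ob q].

(* As E is closed under isomorphism, for an equivalence T this says that T and
   its quasi-inverse are exact, i.e. that T is an equivalence of the exact
   category (C, E) and not only of C. *)
Definition exact_both_ways (T : addFunctor C C) : Prop :=
  forall (x y z : C) (l : hom x y) (p : hom y z),
    E l p <-> E (fmor T l) (fmor T p).

End Exact.

Section Factorizations.
Variables (A : preaddCat) (T : addFunctor A A).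
Variable w : natTrans (idFunctor A) T.

(* m stands for n - 1: the objects are X^0, ..., X^m, with X^j written
   X (inord j). *)
Variable m : nat.

Section Composites.
Variable X : 'I_m.+1 -> A.
Variable d : forall i : 'I_m, hom (X (inord i)) (X (inord i.+1)).
Variable dlast : hom (X (inord m)) (T (X (inord 0))).

(* d^{k-1} ∘ ... ∘ d^0 *)
Fixpoint comp_from0 (k : nat) : (k <= m)%N -> hom (X (inord 0)) (X (inord k)) :=
  match k with
  | 0 => fun _ => idm (X (inord 0))
  | k'.+1 => fun h => d (Ordinal h) ∘ comp_from0 (ltnW h)
  end.

Lemma step_lt (k i : nat) : (k.+1 + i)%N = m -> (i < m)%N.
Proof. by move=> <-; rewrite addSn ltnS leq_addl. Qed.

Lemma step_eq (k i : nat) : (k.+1 + i)%N = m -> (k + i.+1)%N = m.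
Proof. by rewrite addnS. Qed.

(* d^m ∘ d^{m-1} ∘ ... ∘ d^i, by recursion on k = m - i *)
Fixpoint comp_to_end (k i : nat) :
    (k + i)%N = m -> hom (X (inord i)) (T (X (inord 0))) :=
  match k with
  | 0 => fun e : i = m =>
      match esym e in _ = i' return hom (X (inord i')) (T (X (inord 0))) with
      | erefl => dlast
      end
  | k'.+1 => fun e => comp_to_end (step_eq e) ∘ d (Ordinal (step_lt e))
  end.

End Composites.

Record factorization := Factorization {
  fact_ob :> 'I_m.+1 -> A;
  fact_d : forall i : 'I_m, hom (fact_ob (inord i)) (fact_ob (inord i.+1));
  fact_dlast : hom (fact_ob (inord m)) (T (fact_ob (inord 0)));
  fact_eq0 : comp_to_end fact_d fact_dlast (addn0 m) = w (fact_ob (inord 0));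
  fact_eq : forall (j : nat) (hj : (j <= m)%N), (1 <= j)%N ->
    fmor T (comp_from0 fact_d hj) ∘ comp_to_end fact_d fact_dlast (subnK hj)
      = w (fact_ob (inord j))
}.

Record fact_hom (X Y : factorization) := FactHom {
  fact_map :> forall j : 'I_m.+1, hom (X j) (Y j);
  fact_map_d : forall i : 'I_m,
    fact_map (inord i.+1) ∘ fact_d X i = fact_d Y i ∘ fact_map (inord i);
  fact_map_dlast :
    fmor T (fact_map (inord 0)) ∘ fact_dlast X
      = fact_dlast Y ∘ fact_map (inord m)
}.

Lemma fact_hom_eq (X Y : factorization) (f g : fact_hom X Y) :
  (forall j, f j = g j) -> f = g.
Proof.
case: f g => [f fd fl] [g gd gl] /= fg.
have e : f = g by apply: functional_extensionality_dep.
by subst g; congr FactHom; apply: Prop_irrelevance.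
Qed.

Section HomZmod.
Variables X Y : factorization.

HB.instance Definition _ := gen_eqMixin (fact_hom X Y).
HB.instance Definition _ := gen_choiceMixin (fact_hom X Y).

Lemma comp0l (C : preaddCat) (x y z : C) (f : hom x y) :
  (0 : hom y z) ∘ f = 0.
Proof. by apply: (addrI (0 ∘ f)); rewrite -compDl !addr0. Qed.

Lemma comp0r (C : preaddCat) (x y z : C) (g : hom y z) :
  g ∘ (0 : hom x y) = 0.
Proof. by apply: (addrI (g ∘ 0)); rewrite -compDr !addr0. Qed.

Lemma compNl (C : preaddCat) (x y z : C) (g : hom y z) (f : hom x y) :
  (- g) ∘ f = - (g ∘ f).
Proof. by apply: (addrI (g ∘ f)); rewrite -compDl !subrr comp0l. Qed.

Lemma compNr (C : preaddCat) (x y z : C) (g : hom y z) (f : hom x y) :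
  g ∘ (- f) = - (g ∘ f).
Proof. by apply: (addrI (g ∘ f)); rewrite -compDr !subrr comp0r. Qed.

Lemma fmor0 (C D : preaddCat) (F : addFunctor C D) (x y : C) :
  fmor F (0 : hom x y) = 0.
Proof. by apply: (addrI (fmor F 0)); rewrite -fmorD !addr0. Qed.

Lemma fmorN (C D : preaddCat) (F : addFunctor C D) (x y : C) (f : hom x y) :
  fmor F (- f) = - fmor F f.
Proof. by apply: (addrI (fmor F f)); rewrite -fmorD !subrr fmor0. Qed.

Definition fact_zero : fact_hom X Y.
Proof.
exists (fun j => 0); first by move=> i; rewrite comp0l comp0r.
by rewrite fmor0 comp0l comp0r.
Defined.

Definition fact_opp (f : fact_hom X Y) : fact_hom X Y.
Proof.
exists (fun j => - f j).
  by move=> i; rewrite compNl compNr fact_map_d.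
by rewrite fmorN compNl compNr fact_map_dlast.
Defined.

Definition fact_add (f g : fact_hom X Y) : fact_hom X Y.
Proof.
exists (fun j => f j + g j).
  by move=> i; rewrite compDl compDr !fact_map_d.
by rewrite fmorD compDl compDr !fact_map_dlast.
Defined.

Lemma fact_addA : associative fact_add.
Proof. by move=> f g h; apply: fact_hom_eq => j /=; rewrite addrA. Qed.

Lemma fact_addC : commutative fact_add.
Proof. by move=> f g; apply: fact_hom_eq => j /=; rewrite addrC. Qed.

Lemma fact_add0 : left_id fact_zero fact_add.
Proof. by move=> f; apply: fact_hom_eq => j /=; rewrite add0r. Qed.

Lemma fact_addN : left_inverse fact_zero fact_opp fact_add.
Proof. by move=> f; apply: fact_hom_eq => j /=; rewrite addNr. Qed.

HB.instance Definition _ := GRing.isZmodule.Build (fact_hom X Y)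
  fact_addA fact_addC fact_add0 fact_addN.

End HomZmod.

Definition fact_id (X : factorization) : fact_hom X X.
Proof.
exists (fun j => idm (X j)); first by move=> i; rewrite comp_idl comp_idr.
by rewrite fmor_id comp_idl comp_idr.
Defined.

Definition fact_comp (X Y Z : factorization) (g : fact_hom Y Z)
  (f : fact_hom X Y) : fact_hom X Z.
Proof.
exists (fun j => g j ∘ f j).
  by move=> i; rewrite -compA fact_map_d compA fact_map_d compA.
by rewrite fmor_comp -compA fact_map_dlast compA fact_map_dlast compA.
Defined.

Lemma fact_comp_idl (X Y : factorization) (f : fact_hom X Y) :
  fact_comp (fact_id Y) f = f.
Proof. by apply: fact_hom_eq => j /=; rewrite comp_idl. Qed.

Lemma fact_comp_idr (X Y : factorization) (f : fact_hom X Y) :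
  fact_comp f (fact_id X) = f.
Proof. by apply: fact_hom_eq => j /=; rewrite comp_idr. Qed.

Lemma fact_compA (X Y Z U : factorization) (h : fact_hom Z U)
    (g : fact_hom Y Z) (f : fact_hom X Y) :
  fact_comp h (fact_comp g f) = fact_comp (fact_comp h g) f.
Proof. by apply: fact_hom_eq => j /=; rewrite compA. Qed.

Lemma fact_compDl (X Y Z : factorization) (g g' : fact_hom Y Z)
    (f : fact_hom X Y) :
  fact_comp (g + g') f = fact_comp g f + fact_comp g' f.
Proof. by apply: fact_hom_eq => j /=; rewrite compDl. Qed.

Lemma fact_compDr (X Y Z : factorization) (g : fact_hom Y Z)
    (f f' : fact_hom X Y) :
  fact_comp g (f + f') = fact_comp g f + fact_comp g f'.
Proof. by apply: fact_hom_eq => j /=; rewrite compDr. Qed.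

Definition factCat : preaddCat :=
  @PreaddCat factorization (fun X Y => fact_hom X Y : zmodType) fact_id
    fact_comp fact_comp_idl fact_comp_idr fact_compA fact_compDl fact_compDr.

End Factorizations.

(* Only meant for n >= 1, as Fact 0 is Fact 1. *)
Definition Fact (n : nat) (A : preaddCat) (T : addFunctor A A)
  (w : natTrans (idFunctor A) T) : preaddCat := factCat w n.-1.

Definition Fact_class (n : nat) (A : preaddCat) (T : addFunctor A A)
    (w : natTrans (idFunctor A) T) (E : pair_class A) :
    pair_class (Fact n w) :=
  fun X Y Z l p =>
    forall j : 'I_n.-1.+1,
      E _ _ _ (fact_map (l : fact_hom X Y) j) (fact_map (p : fact_hom Y Z) j).

(* Main.v *)
Require Import Defs.
From mathcomp Require Import all_boot.
From mathcomp Require Import ssralg boolp.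
(* [comp] and [compA] are to mean composition in a category, not of functions *)
Import Defs.

(** The exact structure is inherited componentwise.  Squares of factorizations
    that are pushouts (pullbacks) in each component are pushouts (pullbacks),
    and a componentwise pushout of factorizations can be made into a
    factorization: the structure maps are the induced ones, and the equations
    saying that going once around is [w] hold because they hold after
    composition with the jointly epic maps into the pushout ([pushout_glue]).
    For pullbacks the last structure map lands in [T] of a pullback, so one
    uses that the equivalence [T] preserves pullbacks ([pullback_glue]).
    Cokernels and kernels are pushouts and pullbacks along zero objects.
    Consequently a morphism that is an inflation (deflation) in each component
    is an inflation (deflation), and each of Quillen's axioms for
    factorizations reduces to the same axiom in [A] ([fact_exact]).

    For the Frobenius property, let [block p Q] be the factorization
      [Q = ... = Q -w-> T Q = ... = T Q = T Q]
    with [Q] in the positions [0..p] and [T Q] afterwards.  Evaluation at a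
    position has a right and a left adjoint, and blocks are the values of
    both: [block p Q] is cofreely cogenerated by [Q] at [p] ([block_cofree]),
    and freely generated by [T Q] at [p+1] when [p < m] ([block_free_after]),
    by [Q] at [0] when [p = m] ([block_free_first]).  As deflations and
    inflations are componentwise, a block on a projective-injective [Q] is
    both projective and injective ([block_projinj]); this uses that [T]
    preserves projectives.  Freeness and cofreeness provide, for each position
    [j], a morphism from (to) such a block which is a deflation (inflation) at
    [j], and the finite direct sum over [j] is one in all components.  So each
    factorization is a quotient and a subobject of projective-injective ones;
    since projectives and injectives are then retracts of these, the two
    classes agree ([Frobenius_of_projinj]). *)

Set Implicit Arguments.
Unset Strict Implicit.
Unset Printing Implicit Defensive.

Import GRing.Theory.
Local Open Scope ring_scope.
Local Open Scope cat_scope.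

(** * Additive categories: limits, biproducts, duality *)

Lemma dep_choice (I : Type) (U : I -> Type) (P : forall x, U x -> Prop) :
  (forall x, exists y, P x y) -> exists f : forall x, U x, forall x, P x (f x).
Proof.
move=> H; exists (fun x => projT1 (cid (H x))) => x.
exact: (projT2 (cid (H x))).
Qed.

Section AdditiveBasics.
Variable C : preaddCat.

Lemma zero_ob_to (z x : C) (f : hom x z) : idm z = 0 -> f = 0.
Proof. by move=> z0; rewrite -(comp_idl f) z0 comp0l. Qed.

Lemma zero_ob_from (z x : C) (f : hom z x) : idm z = 0 -> f = 0.
Proof. by move=> z0; rewrite -(comp_idr f) z0 comp0r. Qed.

Lemma is_iso_id (x : C) : is_iso (idm x).
Proof. by exists (idm x); rewrite comp_idl. Qed.

Lemma cokernel_epi (x y z t : C) (l : hom x y) (p : hom y z) (f g : hom z t) :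
  is_cokernel l p -> f ∘ p = g ∘ p -> f = g.
Proof.
case=> pl0 /(_ t (g ∘ p)); rewrite -compA pl0 comp0r => /(_ erefl) [h [_ hU]] e.
by rewrite -(hU f) // -(hU g).
Qed.

Lemma pushout_epi (x y x' y' t : C) (i : hom x y) (f : hom x x')
    (i' : hom x' y') (f' : hom y y') (h k : hom y' t) :
  is_pushout i f i' f' -> h ∘ i' = k ∘ i' -> h ∘ f' = k ∘ f' -> h = k.
Proof.
case=> sq /(_ t (k ∘ i') (k ∘ f')); rewrite -!compA sq => /(_ erefl).
by case=> g [_ gU] e1 e2; rewrite -(gU h) // -(gU k).
Qed.

Lemma pullback_mono (y z y' z' t : C) (p : hom y z) (f : hom z' z)
    (p' : hom y' z') (f' : hom y' y) (h k : hom t y') :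
  is_pullback p f p' f' -> p' ∘ h = p' ∘ k -> f' ∘ h = f' ∘ k -> h = k.
Proof.
case=> sq /(_ t (p' ∘ k) (f' ∘ k)); rewrite !compA sq => /(_ erefl).
by case=> g [_ gU] e1 e2; rewrite -(gU h) // -(gU k).
Qed.

(** This turns kernels, and dually cokernels, into an instance of pullbacks and
    pushouts, so that only the latter need a componentwise theory. *)
Lemma kernel_pullback (z0 x y z : C) (l : hom x y) (p : hom y z) :
  idm z0 = 0 -> is_kernel l p <-> is_pullback p (0 : hom z0 z) 0 l.
Proof.
move=> z0P; split=> [] [e U]; split.
- by rewrite e comp0l.
- move=> t u v; rewrite comp0l => /esym /U [h [hE hU]]; exists h; split.
    by split=> //; rewrite comp0l [RHS](zero_ob_to _ z0P).
  by move=> k [_ /hU].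
- by rewrite -e comp0l.
- move=> t f pf; have [|h [[_ hE] hU]] := U t 0 f; first by rewrite pf comp0l.
  exists h; split=> // k kE; apply: hU; split=> //.
  by rewrite comp0l.
Qed.

Definition is_biproduct (x y s : C) (i1 : hom x s) (i2 : hom y s)
    (p1 : hom s x) (p2 : hom s y) : Prop :=
  [/\ p1 ∘ i1 = idm x, p2 ∘ i2 = idm y, p1 ∘ i2 = 0, p2 ∘ i1 = 0
    & i1 ∘ p1 + i2 ∘ p2 = idm s].

Lemma biproduct_to_eq (x y s t : C) (i1 : hom x s) (i2 : hom y s)
    (p1 : hom s x) (p2 : hom s y) (f g : hom t s) :
  is_biproduct i1 i2 p1 p2 -> p1 ∘ f = p1 ∘ g -> p2 ∘ f = p2 ∘ g -> f = g.
Proof.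
case=> _ _ _ _ e e1 e2.
by rewrite -(comp_idl f) -(comp_idl g) -e !compDl -!compA e1 e2.
Qed.

Lemma biproduct_from_eq (x y s t : C) (i1 : hom x s) (i2 : hom y s)
    (p1 : hom s x) (p2 : hom s y) (f g : hom s t) :
  is_biproduct i1 i2 p1 p2 -> f ∘ i1 = g ∘ i1 -> f ∘ i2 = g ∘ i2 -> f = g.
Proof.
case=> _ _ _ _ e e1 e2.
by rewrite -(comp_idr f) -(comp_idr g) -e !compDr !compA e1 e2.
Qed.

Section BiproductCalculus.
Variables (x y s : C) (i1 : hom x s) (i2 : hom y s).
Variables (p1 : hom s x) (p2 : hom s y).
Hypothesis bs : is_biproduct i1 i2 p1 p2.

Lemma pair_fst (t : C) (u : hom t x) (v : hom t y) :
  p1 ∘ (i1 ∘ u + i2 ∘ v) = u.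
Proof.
by have [e1 _ e3 _ _] := bs; rewrite compDr !compA e1 e3 comp_idl comp0l addr0.
Qed.

Lemma pair_snd (t : C) (u : hom t x) (v : hom t y) :
  p2 ∘ (i1 ∘ u + i2 ∘ v) = v.
Proof.
by have [_ e2 _ e4 _] := bs; rewrite compDr !compA e2 e4 comp_idl comp0l add0r.
Qed.

Lemma copair_inl (t : C) (f : hom x t) (g : hom y t) :
  (f ∘ p1 + g ∘ p2) ∘ i1 = f.
Proof.
have [e1 _ _ e4 _] := bs.
by rewrite compDl -!compA e1 e4 comp_idr comp0r addr0.
Qed.

Lemma copair_inr (t : C) (f : hom x t) (g : hom y t) :
  (f ∘ p1 + g ∘ p2) ∘ i2 = g.
Proof.
have [_ e2 e3 _ _] := bs.
by rewrite compDl -!compA e2 e3 comp_idr comp0r add0r.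
Qed.

End BiproductCalculus.

(** Composition is reversed on the nose, so that pushouts, cokernels and
    inflations of [C] are convertible to pullbacks, kernels and deflations of
    [opCat C]. *)
Definition opCat : preaddCat :=
  @PreaddCat C (fun x y => hom y x) (@idm C) (fun x y z g f => comp f g)
    (fun x y f => comp_idr f) (fun x y f => comp_idl f)
    (fun x y z t h g f => esym (compA f g h))
    (fun x y z g g' f => compDr f g g') (fun x y z g f f' => compDl f f' g).

End AdditiveBasics.

Lemma biproductC (C : preaddCat) (x y s : C) (i1 : hom x s) (i2 : hom y s)
    (p1 : hom s x) (p2 : hom s y) :
  is_biproduct i1 i2 p1 p2 -> is_biproduct i2 i1 p2 p1.
Proof. by case=> e1 e2 e3 e4 e5; split=> //; rewrite addrC. Qed.

Lemma cokernel_pushout (C : preaddCat) (z0 x y z : C) (l : hom x y)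
    (p : hom y z) :
  idm z0 = 0 -> is_cokernel l p <-> is_pushout l (0 : hom x z0) 0 p.
Proof. exact: (@kernel_pullback (opCat C)). Qed.

Definition opClass (C : preaddCat) (E : pair_class C) : pair_class (opCat C) :=
  fun x y z l p => E z y x p l.

Lemma is_exact_op (C : preaddCat) (E : pair_class C) :
  is_exact E -> is_exact (opClass E).
Proof.
case=> [[Z B] K CK I ii di ic dc ip dp]; split=> //.
- split=> // x y; have [s [i1 [i2 [p1 [p2 [e1 e2 e3 e4 e5]]]]]] := B x y.
  by exists s, p1, p2, i1, i2; split.
- by move=> x y z l p; apply: CK.
- by move=> x y z l p; apply: K.
- move=> x y z x' y' z' l p l' p' a b c [a' [a1 a2]] [b' [b1 b2]] [c' [c1 c2]].
  rewrite /= in l p l' p' a a' a1 a2 b b' b1 b2 c c' c1 c2 *.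
  move=> /= e1 e2 Epl.
  apply: (I _ _ _ _ _ _ _ _ _ _ c' b' a');
    [by exists c | by exists b | by exists a | | | exact: Epl].
  + by rewrite -[LHS]comp_idr -c1 -!compA (compA p) e2 !compA b2 comp_idl.
  + by rewrite -[LHS]comp_idr -b1 -!compA (compA l) e1 !compA a2 comp_idl.
- by move=> x y z f g df dg; exact: (dc _ _ _ g f dg df).
- by move=> x y z f g df dg; exact: (ic _ _ _ g f dg df).
- by move=> x y x' i f; apply: dp.
- by move=> y z z' p f; apply: ip.
Qed.

(** * Exact categories *)

Section ExactBasics.
Variables (C : preaddCat) (E : pair_class C).
Hypothesis exE : is_exact E.

(** The cokernel of an identity is a zero object, so the axiom that identities
    are inflations says that maps to zero are deflations. *)
Lemma deflation_to_zero_ob :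
  exists z : C, idm z = 0 /\ forall y, deflation E (0 : hom y z).
Proof.
have [z z0] := (exact_additive exE).1; exists z; split=> // y.
have [c [q Eq]] := inflation_id exE y.
have q0 : q = 0 by have [] := exact_kernel exE Eq; rewrite comp_idr.
have c0 : idm c = 0.
  by apply: (cokernel_epi (exact_cokernel exE Eq)); rewrite q0 !comp0r.
exists y, (idm y).
apply: (exact_iso exE (c := (0 : hom c z)) (is_iso_id y) (is_iso_id y) _ _ _ Eq).
- by exists 0; split; rewrite comp0l.
- by [].
- by rewrite q0 !comp0l.
Qed.

Lemma deflation_comp_iso (x y z : C) (u : hom x y) (p : hom y z) :
  is_iso u -> deflation E p -> deflation E (p ∘ u).
Proof.
case=> v [vu uv] [k [l Elp]]; exists k, (v ∘ l).
apply: (exact_iso exE (is_iso_id k) _ (is_iso_id z) _ _ Elp).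
- by exists u; split; [exact: uv | exact: vu].
- by rewrite comp_idr.
- by rewrite comp_idl -compA uv comp_idr.
Qed.

Lemma deflation_of_pullback (y z y' z' : C) (p : hom y z) (f : hom z' z)
    (p' : hom y' z') (f' : hom y' y) :
  deflation E p -> is_pullback p f p' f' -> deflation E p'.
Proof.
move=> dp pb; have [y1 [p1 [f1 [pb1 dp1]]]] := deflation_pullback exE f dp.
have [u [[u1 u2] _]] := pb1.2 _ p' f' pb.1.
have [v [[v1 v2] _]] := pb.2 _ p1 f1 pb1.1.
rewrite -u1; apply: deflation_comp_iso => //; exists v; split.
- by apply: (pullback_mono pb); rewrite compA ?v1 ?v2 ?u1 ?u2 comp_idr.
- by apply: (pullback_mono pb1); rewrite compA ?v1 ?v2 ?u1 ?u2 comp_idr.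
Qed.

(** The map factors as [f + id : x + y -> z + y] followed by
    [(id, g) : z + y -> z].  The first is the pullback of [f] along the
    projection [z + y -> z]; the second is the pullback of [y -> 0] along
    [z -> 0]. *)
Lemma deflation_copair (x y z s : C) (i1 : hom x s) (i2 : hom y s)
    (p1 : hom s x) (p2 : hom s y) (f : hom x z) (g : hom y z) :
  is_biproduct i1 i2 p1 p2 -> deflation E f ->
  deflation E (f ∘ p1 + g ∘ p2).
Proof.
move=> bs df.
have [r [j1 [j2 [q1 [q2 br]]]]] := (exact_additive exE).2 z y.
have [z0 [z0P dz0]] := deflation_to_zero_ob.
have kcop t (a : hom t z) (b : hom t y) :
    (q1 + g ∘ q2) ∘ (j1 ∘ a + j2 ∘ b) = a + g ∘ b.
  by rewrite compDl -compA (pair_fst br) (pair_snd br).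
(* [(f, g) = (id, g) (f + id)], through the biproduct [r] of [z] and [y] *)
have -> : f ∘ p1 + g ∘ p2 = (q1 + g ∘ q2) ∘ (j1 ∘ (f ∘ p1) + j2 ∘ p2).
  by rewrite kcop.
apply: (deflation_comp exE).
- apply: (deflation_of_pullback (p := f) (f := q1) (f' := p1) df); split.
    exact: (pair_fst br).
  move=> t u v uv; exists (i1 ∘ v + i2 ∘ (q2 ∘ u)); split.
    split; last exact: (pair_fst bs).
    apply: (biproduct_to_eq br); rewrite compA.
      by rewrite (pair_fst br) -compA (pair_fst bs).
    by rewrite (pair_snd br) (pair_snd bs).
  move=> h [hu hv]; apply: (biproduct_to_eq bs); first by rewrite (pair_fst bs).
  by rewrite (pair_snd bs) -hu compA (pair_snd br).
- apply: (deflation_of_pullback (f := (0 : hom z z0)) (f' := q2) (dz0 y)).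
  split; first by rewrite !comp0l.
  move=> t u v _; exists (j1 ∘ (u - g ∘ v) + j2 ∘ v); split.
    by rewrite kcop (pair_snd br) subrK.
  move=> h [hu hv]; apply: (biproduct_to_eq br); last by rewrite (pair_snd br).
  by rewrite (pair_fst br) -hu -hv compDl -compA addrK.
Qed.

End ExactBasics.

Lemma inflation_pair (C : preaddCat) (E : pair_class C) (x y z s : C)
    (i1 : hom x s) (i2 : hom y s) (p1 : hom s x) (p2 : hom s y)
    (f : hom z x) (g : hom z y) :
  is_exact E -> is_biproduct i1 i2 p1 p2 -> inflation E f ->
  inflation E (i1 ∘ f + i2 ∘ g).
Proof.
move=> /is_exact_op exE [e1 e2 e3 e4 e5] df.
by apply: (@deflation_copair (opCat C) (opClass E) exE _ _ _ _ p1 p2 i1 i2).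
Qed.

Lemma inflation_iso_comp (C : preaddCat) (E : pair_class C) (x y z : C)
    (u : hom y z) (l : hom x y) :
  is_exact E -> is_iso u -> inflation E l -> inflation E (u ∘ l).
Proof.
move=> /is_exact_op exE [v [vu uv]] dl.
apply: (@deflation_comp_iso (opCat C) (opClass E) exE z y x u l) dl.
by exists v.
Qed.

Section ProjInj.
Variables (C : preaddCat) (E : pair_class C).

Lemma projective_biproduct (x y s : C) (i1 : hom x s) (i2 : hom y s)
    (p1 : hom s x) (p2 : hom s y) :
  is_biproduct i1 i2 p1 p2 -> projective E x -> projective E y ->
  projective E s.
Proof.
move=> bs px py u v p f dp.
have [g1 e1] := px _ _ p (f ∘ i1) dp; have [g2 e2] := py _ _ p (f ∘ i2) dp.
exists (g1 ∘ p1 + g2 ∘ p2); apply: (biproduct_from_eq bs).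
  by rewrite -compA (copair_inl bs).
by rewrite -compA (copair_inr bs).
Qed.

Lemma injective_biproduct (x y s : C) (i1 : hom x s) (i2 : hom y s)
    (p1 : hom s x) (p2 : hom s y) :
  is_biproduct i1 i2 p1 p2 -> injective_ob E x -> injective_ob E y ->
  injective_ob E s.
Proof.
move=> bs jx jy u v l f dl.
have [g1 e1] := jx _ _ l (p1 ∘ f) dl; have [g2 e2] := jy _ _ l (p2 ∘ f) dl.
exists (i1 ∘ g1 + i2 ∘ g2); apply: (biproduct_to_eq bs).
  by rewrite compA (pair_fst bs).
by rewrite compA (pair_snd bs).
Qed.

Lemma projective_retract (x y : C) (r : hom y x) (s : hom x y) :
  r ∘ s = idm x -> projective E y -> projective E x.
Proof.
move=> rs py u v p f dp; have [g e] := py _ _ p (f ∘ r) dp.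
by exists (g ∘ s); rewrite compA e -compA rs comp_idr.
Qed.

Lemma injective_retract (x y : C) (r : hom y x) (s : hom x y) :
  r ∘ s = idm x -> injective_ob E y -> injective_ob E x.
Proof.
move=> rs jy u v l f dl; have [g e] := jy _ _ l (s ∘ f) dl.
by exists (r ∘ g); rewrite -compA e compA rs comp_idl.
Qed.

(** Every projective is a retract of a projective-injective object that covers
    it, hence injective, and dually. *)
Lemma Frobenius_of_projinj : is_exact E ->
  (forall x : C, exists (q : C) (p : hom q x),
     [/\ projective E q, injective_ob E q & deflation E p]) ->
  (forall x : C, exists (q : C) (l : hom x q),
     [/\ projective E q, injective_ob E q & inflation E l]) ->
  is_Frobenius E.
Proof.
move=> exE EP EI; split=> // [x|x|x].
- by have [q [p [pq iq dp]]] := EP x; exists q, p.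
- by have [q [l [pq iq dl]]] := EI x; exists q, l.
- split=> Hx.
    have [q [p [pq iq dp]]] := EP x.
    by have [s ps] := Hx _ _ p (idm x) dp; apply: injective_retract ps iq.
  have [q [l [pq iq dl]]] := EI x.
  by have [r rl] := Hx _ _ l (idm x) dl; apply: projective_retract rl pq.
Qed.

End ProjInj.

(** * Additive autoequivalences *)

Section Equivalence.
Variables (A : preaddCat) (T : addFunctor A A).
Hypothesis hT : is_equivalence T.

Lemma iso_epi (C : preaddCat) (x y z : C) (a : hom x y) (f g : hom y z) :
  is_iso a -> f ∘ a = g ∘ a -> f = g.
Proof.
case=> b [_ ab] e.
by rewrite -(comp_idr f) -(comp_idr g) -ab !compA e.
Qed.

Lemma iso_mono (C : preaddCat) (x y z : C) (a : hom y z) (f g : hom x y) :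
  is_iso a -> a ∘ f = a ∘ g -> f = g.
Proof.
case=> b [ba _] e.
by rewrite -(comp_idl f) -(comp_idl g) -ba -!compA e.
Qed.

Lemma nat_iso_id_faithful (F : addFunctor A A) (x y : A) (f g : hom x y) :
  nat_isomorphic F (idFunctor A) -> fmor F f = fmor F g -> f = g.
Proof.
case=> a ia e; apply: (iso_epi (ia x)).
have /= <- := natural a f; have /= <- := natural a g.
by rewrite e.
Qed.

Lemma equiv_faithful (x y : A) (f g : hom x y) : fmor T f = fmor T g -> f = g.
Proof.
have [S [iST _]] := hT; move=> e; apply: (nat_iso_id_faithful iST) => /=.
by rewrite e.
Qed.

Lemma equiv_full (x y : A) (f : hom (T x) (T y)) : exists g, fmor T g = f.
Proof.
have [S [[a ia] iTS]] := hT; have [a' [a'a aa']] := ia x.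
exists (a y ∘ fmor S f ∘ a').
have SF u v (h k : hom u v) : fmor S h = fmor S k -> h = k.
  by move=> e; apply: (nat_iso_id_faithful iTS) => /=; rewrite e.
apply: SF; apply: (iso_mono (ia y)).
have /= -> := natural a (a y ∘ fmor S f ∘ a').
by rewrite -!compA a'a comp_idr.
Qed.

Lemma equiv_ess_surj (y : A) : exists (x : A) (a : hom (T x) y), is_iso a.
Proof. by have [S [_ [a ia]]] := hT; exists (S y), (a y); exact: ia. Qed.

Lemma equiv_pullback (y z y' z' : A) (p : hom y z) (f : hom z' z)
    (p' : hom y' z') (f' : hom y' y) :
  is_pullback p f p' f' ->
  is_pullback (fmor T p) (fmor T f) (fmor T p') (fmor T f').
Proof.
move=> pb; have [sq U] := pb; split; first by rewrite -!fmor_comp sq.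
move=> t u v uv; have [s [a ia]] := equiv_ess_surj t.
have [u0 eu] := equiv_full (u ∘ a); have [v0 ev] := equiv_full (v ∘ a).
have /U [h [[h1 h2] _]] : f ∘ u0 = p ∘ v0.
  by apply: equiv_faithful; rewrite !fmor_comp eu ev !compA uv.
have [b [ba ab]] := ia.
exists (fmor T h ∘ b); split.
  by rewrite !compA -!fmor_comp h1 h2 eu ev -!compA ab !comp_idr.
move=> k [k1 k2]; have [k0 ek] := equiv_full (k ∘ a).
apply: (iso_epi ia); rewrite -compA ba comp_idr -ek; congr fmor.
apply: (pullback_mono pb); apply: equiv_faithful.
  by rewrite !fmor_comp ek compA k1 -fmor_comp h1 eu.
by rewrite !fmor_comp ek compA k2 -fmor_comp h2 ev.
Qed.

Variable E : pair_class A.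
Hypothesis exE : is_exact E.
Hypothesis hTE : exact_both_ways E T.

Lemma equiv_projective_reflect (q : A) : projective E (T q) -> projective E q.
Proof.
move=> pTq y z p f [k [l Elp]].
have [|g0 e] := pTq _ _ (fmor T p) (fmor T f).
  by exists (T k), (fmor T l); apply: (hTE l p).1.
have [g eg] := equiv_full g0; exists g.
by apply: equiv_faithful; rewrite fmor_comp eg.
Qed.

(** A lifting problem against [p] for [T q] becomes one for [q] against [S p],
    [S] a quasi-inverse.  That [S p] is again a deflation holds because [T]
    reflects conflations and [T S] is isomorphic to the identity. *)
Lemma equiv_projective (q : A) : projective E q -> projective E (T q).
Proof.
move=> pq y z p f [k [l Elp]]; have [S [_ [b ib]]] := hT.
have dSp : deflation E (fmor S p).
  exists (S k), (fmor S l); apply: (hTE _ _).2.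
  have [ck [ck1 ck2]] := ib k; have [cy [cy1 cy2]] := ib y.
  have [cz [cz1 cz2]] := ib z.
  (* the inverse of a natural isomorphism is natural *)
  have inv u v (m : hom u v) cu cv : cu ∘ b u = idm _ -> b u ∘ cu = idm _ ->
      cv ∘ b v = idm _ -> cv ∘ m = fmor T (fmor S m) ∘ cu.
    move=> u1 u2 v1; rewrite -(comp_idr (cv ∘ m)) -u2.
    rewrite compA -(compA cv); have /= <- := natural b m.
    by rewrite (compA cv) v1 comp_idl.
  apply: (exact_iso exE (a := ck) (b := cy) (c := cz) _ _ _ _ _ Elp).
  + by exists (b k).
  + by exists (b y).
  + by exists (b z).
  + exact: inv.
  + exact: inv.
have [cz [cz1 cz2]] := ib z.
have [f' ef] := equiv_full (cz ∘ f).
have [g' eg] := pq _ _ (fmor S p) f' dSp.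
exists (b y ∘ fmor T g').
have /= e := natural b p.
by rewrite compA -e -compA -fmor_comp eg ef compA cz2 comp_idl.
Qed.

End Equivalence.

(** * Composites of the structure maps *)

Section Segments.
Variables (A : preaddCat) (m : nat).
Implicit Types X : 'I_m.+1 -> A.

(** Positions are written [inord k], which is only propositionally equal to a
    given ordinal; this identity map absorbs the difference. *)
Definition transp X (a b : 'I_m.+1) (e : a = b) : hom (X a) (X b) :=
  match e in _ = c return hom (X a) (X c) with erefl => idm (X a) end.

Lemma transp_id X a (e : a = a) : transp X e = idm (X a).
Proof. by rewrite (eq_irrelevance e erefl). Qed.

Lemma transp_comp X a b c (e : a = b) (e' : b = c) :
  transp X e' ∘ transp X e = transp X (etrans e e').
Proof. by subst c b; rewrite /= comp_idl. Qed.

Lemma ord_chain_ind (a : 'I_m.+1) (P : 'I_m.+1 -> Prop) :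
  P a ->
  (forall i : 'I_m, (a <= i)%N -> P (inord i) -> P (inord i.+1)) ->
  forall b : 'I_m.+1, (a <= b)%N -> P b.
Proof.
move=> Pa IH b; rewrite -[b]inord_val inordK //.
elim: (nat_of_ord b) (ltn_ord b) => [|k IHk] km.
  by rewrite leqn0 => /eqP a0; rewrite -a0 inord_val.
rewrite leq_eqVlt => /orP[/eqP <-|]; first by rewrite inord_val.
rewrite ltnS => ak; apply: (IH (Ordinal (km : (k < m)%N))) => //.
exact: (IHk (ltnW km)).
Qed.

Variable X : 'I_m.+1 -> A.
Variable d : forall i : 'I_m, hom (X (inord i)) (X (inord i.+1)).

Fixpoint seg_nat (a : 'I_m.+1) (k : nat) {struct k} : hom (X a) (X (inord k)) :=
  match (a =P inord k) with
  | ReflectT e => transp X e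
  | ReflectF _ =>
    match k return hom (X a) (X (inord k)) with
    | 0 => 0
    | k'.+1 =>
      match @idP (k' < m)%N with
      | ReflectT h => d (Ordinal h) ∘ seg_nat a k'
      | ReflectF _ => 0
      end
    end
  end.

(** The composite of the structure maps from position [a] to position [b];
    junk unless [a <= b].  It is locked since otherwise rewriting with [compA]
    would see the composition in its body. *)
Definition seg (a b : 'I_m.+1) : hom (X a) (X b) :=
  locked (transp X (inord_val b) ∘ seg_nat a b).

Lemma seg_nat_transp a k (e : a = inord k) : seg_nat a k = transp X e.
Proof.
by case: k e => [|k] e /=; case: eqP => // e'; rewrite (eq_irrelevance e' e).
Qed.

Lemma seg_id a : seg a a = idm (X a).
Proof.
rewrite /seg -lock (seg_nat_transp (esym (inord_val a))).
by rewrite transp_comp transp_id.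
Qed.

Lemma seg_inord a k : (k <= m)%N -> seg a (inord k) = seg_nat a k.
Proof.
move=> km; rewrite /seg -lock.
move: (inord_val (inord k)); rewrite (inordK (km : (k < m.+1)%N)) => e.
by rewrite transp_id comp_idl.
Qed.

Lemma seg_step (a : 'I_m.+1) (i : 'I_m) :
  (a <= i)%N -> seg a (inord i.+1) = d i ∘ seg a (inord i).
Proof.
move=> ai; have im := ltn_ord i; rewrite !seg_inord //= ?(ltnW im) //.
case: eqP => [ea|_].
  by exfalso; move: ai; rewrite ea inordK // ltnn.
case: i im ai => i hi im ai /=.
case: {-}_ / idP => [h|]; last by case.
by rewrite (bool_irrelevance h hi).
Qed.

Lemma seg_comp (a b c : 'I_m.+1) :
  (a <= b)%N -> (b <= c)%N -> seg b c ∘ seg a b = seg a c.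
Proof.
move=> ab; move: c; apply: ord_chain_ind; first by rewrite seg_id comp_idl.
move=> i bi IH; rewrite seg_step // -compA IH.
by rewrite seg_step // (leq_trans ab).
Qed.

Lemma seg_d (i : 'I_m) : seg (inord i) (inord i.+1) = d i.
Proof.
by rewrite seg_step ?seg_id ?comp_idr // inordK // ltnS ltnW.
Qed.

End Segments.

(** * Componentwise pushouts, pullbacks and biproducts of factorizations *)

Section FactorizationLaw.
Variables (A : preaddCat) (T : addFunctor A A).
Variable w : natTrans (idFunctor A) T.
Variable m : nat.

Section Around.
Variable X : 'I_m.+1 -> A.
Variable d : forall i : 'I_m, hom (X (inord i)) (X (inord i.+1)).
Variable dl : hom (X (inord m)) (T (X (inord 0))).

(** The composite of all the structure maps once around, starting at [j]; the
    equations of a factorization are uniformly [around j = w]. *)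
Definition around (j : 'I_m.+1) : hom (X j) (T (X j)) :=
  fmor T (seg d (inord 0) j) ∘ (dl ∘ seg d j (inord m)).

Lemma comp_from0E k (hk : (k <= m)%N) :
  comp_from0 d hk = seg d (inord 0) (inord k).
Proof.
elim: k hk => [|k IH] hk /=; first by rewrite seg_id.
by rewrite IH (seg_step d (i := Ordinal hk)) // inordK.
Qed.

Lemma comp_to_endE k i (e : (k + i)%N = m) :
  comp_to_end d dl e = dl ∘ seg d (inord i) (inord m).
Proof.
elim: k i e => [|k IH] i e.
  change (i = m) in e; subst i.
  by rewrite /= seg_id comp_idr.
have im : (i < m)%N := step_lt e.
rewrite /= IH -(seg_d d (Ordinal (step_lt e))) -compA seg_comp //= !inordK //.
exact: leqW.
Qed.

Hypothesis lawP : forall j, around j = w (X j).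

Lemma around_eq0 : comp_to_end d dl (addn0 m) = w (X (inord 0)).
Proof. by rewrite comp_to_endE -lawP /around seg_id fmor_id comp_idl. Qed.

Lemma around_eq (j : nat) (hj : (j <= m)%N) : (1 <= j)%N ->
  fmor T (comp_from0 d hj) ∘ comp_to_end d dl (subnK hj) = w (X (inord j)).
Proof. by rewrite comp_from0E comp_to_endE -lawP. Qed.

Definition mk_fact : factorization w m := Factorization around_eq0 around_eq.

End Around.

Lemma fact_law (X : factorization w m) (j : 'I_m.+1) :
  around (fact_d X) (fact_dlast X) j = w (X j).
Proof.
rewrite -[j]inord_val; have jm : (j <= m)%N := ltn_ord j.
rewrite /around -(comp_from0E _ jm) -(comp_to_endE _ _ (subnK jm)).
have [j0|j0] := posnP j; last exact: fact_eq.
move: jm; rewrite j0 => jm; rewrite fmor_id comp_idl -fact_eq0.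
by rewrite !comp_to_endE.
Qed.

Section Commuting.
Variables X Y : 'I_m.+1 -> A.
Variable dX : forall i : 'I_m, hom (X (inord i)) (X (inord i.+1)).
Variable dY : forall i : 'I_m, hom (Y (inord i)) (Y (inord i.+1)).
Variable g : forall j, hom (X j) (Y j).
Hypothesis gd : forall i : 'I_m, g (inord i.+1) ∘ dX i = dY i ∘ g (inord i).

Lemma seg_natural (a b : 'I_m.+1) :
  (a <= b)%N -> g b ∘ seg dX a b = seg dY a b ∘ g a.
Proof.
move: b; apply: ord_chain_ind; first by rewrite !seg_id comp_idl comp_idr.
by move=> i ai IH; rewrite !seg_step // compA gd -!compA IH.
Qed.

Variable dlX : hom (X (inord m)) (T (X (inord 0))).
Variable dlY : hom (Y (inord m)) (T (Y (inord 0))).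
Hypothesis gl : fmor T (g (inord 0)) ∘ dlX = dlY ∘ g (inord m).

(** The law [around = w] can thus be transported along jointly epic or jointly
    monic families of maps commuting with the structure maps. *)
Lemma around_natural (j : 'I_m.+1) :
  fmor T (g j) ∘ around dX dlX j = around dY dlY j ∘ g j.
Proof.
have jm : (j <= @inord m m)%N by rewrite inordK // -ltnS.
rewrite /around compA -fmor_comp seg_natural ?inordK // fmor_comp -!compA.
by rewrite -seg_natural // !compA -(compA (fmor T _)) gl !compA.
Qed.

End Commuting.

(** The relation [R] carries whatever else is known of the chosen squares in
    [A] (a conflation, an inflation) through the choice of the components. *)
Lemma pushout_glue (X Y X' : factorization w m) (i : fact_hom X Y)
    (f : fact_hom X X')
    (R : forall j (z : A), hom (X' j) z -> hom (Y j) z -> Prop) :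
  (forall j, exists (z : A) (i' : hom (X' j) z) (f' : hom (Y j) z),
     is_pushout (i j) (f j) i' f' /\ R j z i' f') ->
  exists (Z : factorization w m) (i' : fact_hom X' Z) (f' : fact_hom Y Z),
    forall j, is_pushout (i j) (f j) (i' j) (f' j) /\ R j (Z j) (i' j) (f' j).
Proof.
move=> /dep_choice [Z] /dep_choice [i'] /dep_choice [f' H].
have po j := (H j).1.
have /dep_choice [d dP] (k : 'I_m) :
    exists h : hom (Z (inord k)) (Z (inord k.+1)),
      h ∘ i' (inord k) = i' (inord k.+1) ∘ fact_d X' k /\
      h ∘ f' (inord k) = f' (inord k.+1) ∘ fact_d Y k.
  have [|h [hP _]] := (po (inord k)).2 _ (i' (inord k.+1) ∘ fact_d X' k)
                       (f' (inord k.+1) ∘ fact_d Y k); last by exists h.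
  by rewrite -!compA -!fact_map_d !compA (po _).1.
have [|dl [[dl1 dl2] _]] := (po (inord m)).2 _
    (fmor T (i' (inord 0)) ∘ fact_dlast X')
    (fmor T (f' (inord 0)) ∘ fact_dlast Y).
  by rewrite -!compA -!fact_map_dlast !compA -!fmor_comp (po _).1.
have ci (k : 'I_m) : i' (inord k.+1) ∘ fact_d X' k = d k ∘ i' (inord k).
  by rewrite (dP k).1.
have cf (k : 'I_m) : f' (inord k.+1) ∘ fact_d Y k = d k ∘ f' (inord k).
  by rewrite (dP k).2.
have law j : around d dl j = w (Z j).
  apply: (pushout_epi (h := around d dl j) (k := w (Z j)) (po j)).
    rewrite -(around_natural ci (esym dl1)) fact_law; exact: esym (natural w _).
  rewrite -(around_natural cf (esym dl2)) fact_law; exact: esym (natural w _).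
by exists (mk_fact law), (@FactHom _ _ w m X' (mk_fact law) i' ci (esym dl1)),
  (@FactHom _ _ w m Y (mk_fact law) f' cf (esym dl2)).
Qed.

Lemma fact_map_congr (X Y : factCat w m) (f g : hom X Y) j :
  f = g -> fact_map f j = fact_map g j.
Proof. by move=> ->. Qed.

Lemma pushout_componentwise (X Y X' Y' : factCat w m) (i : hom X Y)
    (f : hom X X') (i' : hom X' Y') (f' : hom Y Y') :
  (forall j, is_pushout (fact_map i j) (fact_map f j) (fact_map i' j)
     (fact_map f' j)) ->
  is_pushout i f i' f'.
Proof.
move=> po; split; first by apply: fact_hom_eq => j; exact: (po j).1.
move=> t u v uv.
have uvj j : fact_map u j ∘ fact_map f j = fact_map v j ∘ fact_map i j.
  exact: fact_map_congr j uv.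
have /dep_choice [h hP] : forall j, exists h : hom (fact_ob Y' j) (fact_ob t j),
    h ∘ fact_map i' j = fact_map u j /\ h ∘ fact_map f' j = fact_map v j.
  by move=> j; have [h [hP _]] := (po j).2 _ _ _ (uvj j); exists h.
have hd (k : 'I_m) :
    h (inord k.+1) ∘ fact_d Y' k = fact_d t k ∘ h (inord k).
  apply: (pushout_epi (po (inord k))).
    rewrite -[LHS]compA -fact_map_d compA (hP _).1 fact_map_d.
    by rewrite -[RHS]compA (hP _).1.
  rewrite -[LHS]compA -fact_map_d compA (hP _).2 fact_map_d.
  by rewrite -[RHS]compA (hP _).2.
have hl : fmor T (h (inord 0)) ∘ fact_dlast Y' = fact_dlast t ∘ h (inord m).
  apply: (pushout_epi (po (inord m))).
    rewrite -[LHS]compA -fact_map_dlast compA -fmor_comp (hP _).1.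
    by rewrite fact_map_dlast -[RHS]compA (hP _).1.
  rewrite -[LHS]compA -fact_map_dlast compA -fmor_comp (hP _).2.
  by rewrite fact_map_dlast -[RHS]compA (hP _).2.
exists (FactHom hd hl); split.
  by split; apply: fact_hom_eq => j; [exact: (hP j).1 | exact: (hP j).2].
move=> k [k1 k2]; apply: fact_hom_eq => j.
apply: (pushout_epi (po j)).
  by rewrite /= (hP j).1 -k1.
by rewrite /= (hP j).2 -k2.
Qed.

Hypothesis hT : is_equivalence T.

(** Dual to [pushout_glue], except that the last structure map and the law
    have values in [T] of a pullback. *)
Lemma pullback_glue (Y Z Z' : factorization w m) (p : fact_hom Y Z)
    (f : fact_hom Z' Z)
    (R : forall j (y : A), hom y (Z' j) -> hom y (Y j) -> Prop) :
  (forall j, exists (y : A) (p' : hom y (Z' j)) (f' : hom y (Y j)),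
     is_pullback (p j) (f j) p' f' /\ R j y p' f') ->
  exists (Y' : factorization w m) (p' : fact_hom Y' Z') (f' : fact_hom Y' Y),
    forall j, is_pullback (p j) (f j) (p' j) (f' j) /\ R j (Y' j) (p' j) (f' j).
Proof.
move=> /dep_choice [U] /dep_choice [p'] /dep_choice [f' H].
have pb j := (H j).1; have Tpb j := equiv_pullback hT (pb j).
have /dep_choice [d dP] (k : 'I_m) :
    exists h : hom (U (inord k)) (U (inord k.+1)),
      p' (inord k.+1) ∘ h = fact_d Z' k ∘ p' (inord k) /\
      f' (inord k.+1) ∘ h = fact_d Y k ∘ f' (inord k).
  have [|h [hP _]] := (pb (inord k.+1)).2 _ (fact_d Z' k ∘ p' (inord k))
                       (fact_d Y k ∘ f' (inord k)); last by exists h.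
  by rewrite !compA !fact_map_d -!compA (pb _).1.
have [|dl [[dl1 dl2] _]] := (Tpb (inord 0)).2 _
    (fact_dlast Z' ∘ p' (inord m)) (fact_dlast Y ∘ f' (inord m)).
  by rewrite !compA !fact_map_dlast -!compA (pb _).1.
have cp k := (dP k).1; have cf k := (dP k).2.
have law j : around d dl j = w (U j).
  apply: (pullback_mono (h := around d dl j) (k := w (U j)) (Tpb j)).
    rewrite (around_natural cp dl1) fact_law; exact: (natural w).
  rewrite (around_natural cf dl2) fact_law; exact: (natural w).
by exists (mk_fact law), (@FactHom _ _ w m (mk_fact law) Z' p' cp dl1),
  (@FactHom _ _ w m (mk_fact law) Y f' cf dl2).
Qed.

Lemma pullback_componentwise (Y Z Y' Z' : factCat w m) (p : hom Y Z)
    (f : hom Z' Z) (p' : hom Y' Z') (f' : hom Y' Y) :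
  (forall j, is_pullback (fact_map p j) (fact_map f j) (fact_map p' j)
     (fact_map f' j)) ->
  is_pullback p f p' f'.
Proof.
move=> pb; have Tpb j := equiv_pullback hT (pb j).
split; first by apply: fact_hom_eq => j; exact: (pb j).1.
move=> t u v uv.
have uvj j : fact_map f j ∘ fact_map u j = fact_map p j ∘ fact_map v j.
  exact: fact_map_congr j uv.
have /dep_choice [h hP] : forall j, exists h : hom (fact_ob t j) (fact_ob Y' j),
    fact_map p' j ∘ h = fact_map u j /\ fact_map f' j ∘ h = fact_map v j.
  by move=> j; have [h [hP _]] := (pb j).2 _ _ _ (uvj j); exists h.
have hd (k : 'I_m) :
    h (inord k.+1) ∘ fact_d t k = fact_d Y' k ∘ h (inord k).
  apply: (pullback_mono (pb (inord k.+1))).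
    rewrite compA (hP _).1 fact_map_d [RHS]compA fact_map_d.
    by rewrite -[RHS]compA (hP _).1.
  rewrite compA (hP _).2 fact_map_d [RHS]compA fact_map_d.
  by rewrite -[RHS]compA (hP _).2.
have hl : fmor T (h (inord 0)) ∘ fact_dlast t = fact_dlast Y' ∘ h (inord m).
  apply: (pullback_mono (Tpb (inord 0))).
    rewrite compA -fmor_comp (hP _).1 fact_map_dlast [RHS]compA fact_map_dlast.
    by rewrite -[RHS]compA (hP _).1.
  rewrite compA -fmor_comp (hP _).2 fact_map_dlast [RHS]compA fact_map_dlast.
  by rewrite -[RHS]compA (hP _).2.
exists (FactHom hd hl); split.
  by split; apply: fact_hom_eq => j; [exact: (hP j).1 | exact: (hP j).2].
move=> k [k1 k2]; apply: fact_hom_eq => j.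
apply: (pullback_mono (pb j)).
  by rewrite /= (hP j).1 -k1.
by rewrite /= (hP j).2 -k2.
Qed.

Lemma fact_zero_ob (z : A) : idm z = 0 ->
  exists Z : factCat w m, idm Z = 0 /\ forall j, idm (fact_ob Z j) = 0.
Proof.
move=> z0; pose d (i : 'I_m) : hom z z := 0.
have law j : @around (fun=> z) d 0 j = w z.
  by rewrite [LHS](zero_ob_from _ z0) [RHS](zero_ob_from _ z0).
exists (mk_fact law); split=> [|j]; last exact: z0.
by apply: fact_hom_eq => j; exact: z0.
Qed.

Lemma fact_biproduct (X Y : factCat w m) :
  (forall x y : A, exists (s : A) (i1 : hom x s) (i2 : hom y s)
     (p1 : hom s x) (p2 : hom s y), is_biproduct i1 i2 p1 p2) ->
  exists (S : factCat w m) (i1 : hom X S) (i2 : hom Y S)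
    (p1 : hom S X) (p2 : hom S Y), is_biproduct i1 i2 p1 p2.
Proof.
move=> B.
have := fun j => B (fact_ob X j) (fact_ob Y j).
move=> /dep_choice [S] /dep_choice [i1] /dep_choice [i2] /dep_choice [p1].
move=> /dep_choice [p2 bs].
pose d (k : 'I_m) : hom (S (inord k)) (S (inord k.+1)) :=
  (i1 _ ∘ fact_d X k) ∘ p1 _ + (i2 _ ∘ fact_d Y k) ∘ p2 _.
pose dl : hom (S (inord m)) (T (S (inord 0))) :=
  (fmor T (i1 _) ∘ fact_dlast X) ∘ p1 _ + (fmor T (i2 _) ∘ fact_dlast Y) ∘ p2 _.
have ci1 (k : 'I_m) : i1 (inord k.+1) ∘ fact_d X k = d k ∘ i1 (inord k).
  by rewrite (copair_inl (bs _)).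
have ci2 (k : 'I_m) : i2 (inord k.+1) ∘ fact_d Y k = d k ∘ i2 (inord k).
  by rewrite (copair_inr (bs _)).
have li1 : fmor T (i1 (inord 0)) ∘ fact_dlast X = dl ∘ i1 (inord m).
  by rewrite (copair_inl (bs _)).
have li2 : fmor T (i2 (inord 0)) ∘ fact_dlast Y = dl ∘ i2 (inord m).
  by rewrite (copair_inr (bs _)).
have cp1 (k : 'I_m) : p1 (inord k.+1) ∘ d k = fact_d X k ∘ p1 (inord k).
  by rewrite /d -!compA (pair_fst (bs _)).
have cp2 (k : 'I_m) : p2 (inord k.+1) ∘ d k = fact_d Y k ∘ p2 (inord k).
  by rewrite /d -!compA (pair_snd (bs _)).
have Tbs j : is_biproduct (fmor T (i1 j)) (fmor T (i2 j)) (fmor T (p1 j))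
    (fmor T (p2 j)).
  have [e1 e2 e3 e4 e5] := bs j.
  by split; rewrite -!fmor_comp -?fmorD ?e1 ?e2 ?e3 ?e4 ?e5 ?fmor_id ?fmor0.
have lp1 : fmor T (p1 (inord 0)) ∘ dl = fact_dlast X ∘ p1 (inord m).
  by rewrite /dl -!compA (pair_fst (Tbs _)).
have lp2 : fmor T (p2 (inord 0)) ∘ dl = fact_dlast Y ∘ p2 (inord m).
  by rewrite /dl -!compA (pair_snd (Tbs _)).
have law j : around d dl j = w (S j).
  apply: (biproduct_from_eq (f := around d dl j) (g := w (S j)) (bs j)).
    rewrite -(around_natural ci1 li1) fact_law; exact: esym (natural w _).
  rewrite -(around_natural ci2 li2) fact_law; exact: esym (natural w _).
exists (mk_fact law), (@FactHom _ _ w m X (mk_fact law) i1 ci1 li1),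
  (@FactHom _ _ w m Y (mk_fact law) i2 ci2 li2),
  (@FactHom _ _ w m (mk_fact law) X p1 cp1 lp1),
  (@FactHom _ _ w m (mk_fact law) Y p2 cp2 lp2).
by split; apply: fact_hom_eq => j /=; have [e1 e2 e3 e4 e5] := bs j.
Qed.

End FactorizationLaw.

(** * The exact structure on factorizations *)

Section FactorizationExact.
Variables (A : preaddCat) (E : pair_class A).
Variable T : addFunctor A A.
Variable w : natTrans (idFunctor A) T.
Variable m : nat.
Hypothesis exE : is_exact E.
Hypothesis hT : is_equivalence T.

Definition fact_class : pair_class (factCat w m) :=
  fun X Y Z l p => forall j, E (fact_map l j) (fact_map p j).

(** The componentwise cokernels are pushouts along the zero factorization,
    hence glue to a cokernel that completes [l] to a conflation. *)
Lemma inflation_componentwise (X Y : factCat w m) (l : hom X Y) :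
  (forall j, inflation E (fact_map l j)) -> inflation fact_class l.
Proof.
move=> il; have [z z0] := (exact_additive exE).1.
have [Z0 [_ Z0P]] := fact_zero_ob w m z0.
have [j|Z [i' [p H]]] := @pushout_glue _ _ w m X Y Z0 l (fact_zero X Z0)
    (fun j z _ p => E (fact_map l j) p).
  have [z1 [p Elp]] := il j; exists z1, 0, p; split=> //.
  exact: (cokernel_pushout _ _ (Z0P j)).1 (exact_cokernel exE Elp).
by exists Z, p => j; exact: (H j).2.
Qed.

Lemma deflation_componentwise (Y Z : factCat w m) (p : hom Y Z) :
  (forall j, deflation E (fact_map p j)) -> deflation fact_class p.
Proof.
move=> dp; have [z z0] := (exact_additive exE).1.
have [Z0 [_ Z0P]] := fact_zero_ob w m z0.
have [j|X [p' [l H]]] := @pullback_glue _ _ w m hT Y Z Z0 p (fact_zero Z0 Z)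
    (fun j y _ l => E l (fact_map p j)).
  have [x [l Elp]] := dp j; exists x, 0, l; split=> //.
  exact: (kernel_pullback _ _ (Z0P j)).1 (exact_kernel exE Elp).
by exists X, l => j; exact: (H j).2.
Qed.

Lemma inflation_at (X Y : factCat w m) (l : hom X Y) j :
  inflation fact_class l -> inflation E (fact_map l j).
Proof. by case=> Z [p H]; exists (fact_ob Z j), (fact_map p j). Qed.

Lemma deflation_at (Y Z : factCat w m) (p : hom Y Z) j :
  deflation fact_class p -> deflation E (fact_map p j).
Proof. by case=> X [l H]; exists (fact_ob X j), (fact_map l j). Qed.

Lemma fact_iso_at (X Y : factCat w m) (f : hom X Y) j :
  is_iso f -> is_iso (fact_map f j).
Proof.
case=> g [gf fg]; exists (fact_map g j); split.
  exact: (fact_map_congr j gf).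
exact: (fact_map_congr j fg).
Qed.

Lemma fact_exact : is_exact fact_class.
Proof.
have [z z0] := (exact_additive exE).1.
have [Z0 [Z0i Z0P]] := fact_zero_ob w m z0.
split.
- split; first by exists Z0.
  by move=> X Y; exact: fact_biproduct (exact_additive exE).2.
- move=> X Y Z l p H; apply: (kernel_pullback _ _ Z0i).2.
  apply: (pullback_componentwise hT) => j.
  exact: (kernel_pullback _ _ (Z0P j)).1 (exact_kernel exE (H j)).
- move=> X Y Z l p H; apply: (cokernel_pushout _ _ Z0i).2.
  apply: pushout_componentwise => j.
  exact: (cokernel_pushout _ _ (Z0P j)).1 (exact_cokernel exE (H j)).
- move=> X Y Z X' Y' Z' l p l' p' a b c ia ib ic e1 e2 H j.
  apply: (exact_iso exE (fact_iso_at j ia) (fact_iso_at j ib)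
    (fact_iso_at j ic) _ _ (H j)).
    exact: (fact_map_congr j e1).
  exact: (fact_map_congr j e2).
- by move=> X; apply: inflation_componentwise => j; exact: (inflation_id exE).
- by move=> X; apply: deflation_componentwise => j; exact: (deflation_id exE).
- move=> X Y Z f g df dg; apply: inflation_componentwise => j.
  by apply: (inflation_comp exE); apply: inflation_at.
- move=> X Y Z f g df dg; apply: deflation_componentwise => j.
  by apply: (deflation_comp exE); apply: deflation_at.
- move=> X Y X' i f di.
  have [j|Y' [i' [f' H]]] := @pushout_glue _ _ w m X Y X' i f
      (fun j z i' _ => inflation E i').
    exact: (inflation_pushout exE (fact_map f j) (inflation_at j di)).
  exists Y', i', f'; split.
    by apply: pushout_componentwise => j; exact: (H j).1.
  by apply: inflation_componentwise => j; exact: (H j).2.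
- move=> Y Z Z' p f dp.
  have [j|Y' [p' [f' H]]] := @pullback_glue _ _ w m hT Y Z Z' p f
      (fun j z p' _ => deflation E p').
    exact: (deflation_pullback exE (fact_map f j) (deflation_at j dp)).
  exists Y', p', f'; split.
    by apply: (pullback_componentwise hT) => j; exact: (H j).1.
  by apply: deflation_componentwise => j; exact: (H j).2.
Qed.

(** [G] is the value at [P] of the left adjoint of evaluation at [j], with unit
    [u]. *)
Definition free_at (G : factorization w m) j (P : A) (u : hom P (G j)) : Prop :=
  forall (Y : factorization w m) (g0 : hom P (Y j)),
    exists! g : fact_hom G Y, g j ∘ u = g0.

(** [G] is the value at [Q] of the right adjoint of evaluation at [j], with
    counit [v]. *)
Definition cofree_at (G : factorization w m) j (Q : A) (v : hom (G j) Q) :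
    Prop :=
  forall (Y : factorization w m) (g0 : hom (Y j) Q),
    exists! g : fact_hom Y G, v ∘ g j = g0.

(** Left adjoints of exact functors preserve projectives. *)
Lemma free_projective G j P (u : hom P (fact_ob G j)) :
  free_at u -> projective E P -> projective fact_class G.
Proof.
move=> fr pP Y Z p f /(deflation_at j) dp.
have [g0 e0] := pP _ _ _ (fact_map f j ∘ u) dp.
have [g [eg _]] := fr Y g0; exists g.
have [h [_ hU]] := fr Z (fact_map f j ∘ u).
rewrite -(hU f erefl); apply/esym/hU.
by rewrite -e0 -eg compA.
Qed.

Lemma cofree_injective G j Q (v : hom (fact_ob G j) Q) :
  cofree_at v -> injective_ob E Q -> injective_ob fact_class G.
Proof.
move=> fr jQ X Y l f /(inflation_at j) dl.
have [g0 e0] := jQ _ _ _ (v ∘ fact_map f j) dl.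
have [g [eg _]] := fr Y g0; exists g.
have [h [_ hU]] := fr X (v ∘ fact_map f j).
rewrite -(hU f erefl); apply/esym/hU.
by rewrite -e0 -eg compA.
Qed.

End FactorizationExact.

(** * Block factorizations and their universal properties *)

Section Block.
Variables (A : preaddCat) (T : addFunctor A A).
Variable w : natTrans (idFunctor A) T.
Hypothesis hw : forall X : A, w (T X) = fmor T (w X).
Variable m : nat.
Variables (p : 'I_m.+1) (Q : A).

(** The boolean tells whether the position is at most [p].  Indexing by it,
    instead of by positions, makes all objects and maps of a block compute. *)
Definition block_ob (b : bool) : A := if b then Q else T Q.

(** The value [0] is junk: as positions increase, the boolean never goes from
    [false] to [true]. *)
Definition block_map (b c : bool) : hom (block_ob b) (block_ob c) :=
  match b, c with
  | true, true => idm Q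
  | true, false => w Q
  | false, true => 0
  | false, false => idm (T Q)
  end.

(** Position [0] is always at most [p], so [c = false] does not occur. *)
Definition block_last (b c : bool) : hom (block_ob b) (T (block_ob c)) :=
  match b, c with
  | true, true => w Q
  | false, true => idm (T Q)
  | _, false => 0
  end.

Lemma block_map_id b : block_map b b = idm (block_ob b).
Proof. by case: b. Qed.

Lemma block_map_comp a b c : (b ==> a) -> (c ==> b) ->
  block_map b c ∘ block_map a b = block_map a c.
Proof. by case: a b c => [] [] [] //= _ _; rewrite ?comp_idl ?comp_idr. Qed.

Definition block_d (i : 'I_m) :
    hom (block_ob (@inord m i <= p)%N) (block_ob (@inord m i.+1 <= p)%N) :=
  block_map _ _.

Lemma leq_antitone (a b : 'I_m.+1) :
  (a <= b)%N -> (b <= p)%N ==> (a <= p)%N.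
Proof. by move=> ab; apply/implyP; exact: leq_trans. Qed.

Lemma inord0_le (k : 'I_m.+1) : (@inord m 0 <= k)%N.
Proof. by rewrite inordK. Qed.

Lemma le_inordm (k : 'I_m.+1) : (k <= @inord m m)%N.
Proof. by rewrite inordK // -ltnS. Qed.

Lemma inord_step (i : 'I_m) : (@inord m i <= @inord m i.+1)%N.
Proof. by rewrite !inordK ?leqnSn ?ltnS ?ltn_ord // ltnW. Qed.

Lemma seg_block (a b : 'I_m.+1) : (a <= b)%N ->
  seg (X := fun k => block_ob (k <= p)%N) block_d a b
    = block_map (a <= p)%N (b <= p)%N.
Proof.
move: b; apply: ord_chain_ind; first by rewrite seg_id block_map_id.
move=> i ai IH; rewrite seg_step // IH block_map_comp //; apply: leq_antitone.
  by rewrite inordK // ltnW // ltnS.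
exact: inord_step.
Qed.

(** Passing the step from [p] to [p+1], or closing up with [block_last] when
    [p = m], contributes [w Q]; the remaining maps are identities.  For
    positions after [p] the step is seen through [T], whence the hypothesis
    [w (T Q) = T (w Q)]. *)
Lemma block_law j : around (X := fun k => block_ob (k <= p)%N) block_d
  (block_last _ _) j = w (block_ob (j <= p)%N).
Proof.
rewrite /around !seg_block ?inord0_le ?le_inordm //.
have := leq_antitone (le_inordm j).
case: (j <= p)%N; case: (_ <= p)%N => //= _.
- by rewrite fmor_id comp_idl comp_idr.
- by rewrite fmor_id !comp_idl.
- by rewrite !comp_idr hw.
Qed.

Definition block : factorization w m := mk_fact block_law.

Definition block_out : hom (block p) Q := block_map (p <= p)%N true.

(** A map into the block is determined by its component [h] at [p]: before [p]
    it is [h] after the structure maps, and after [p] one first goes around the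
    end and then applies [T] of the component at [0].  The square at the step
    from [p] to [p+1] is the naturality of [w] at [h]. *)
Lemma block_cofree : cofree_at block_out.
Proof.
move=> Y h.
pose g (k : 'I_m.+1) (b : bool) : hom (Y k) (block_ob b) :=
  match b return hom (Y k) (block_ob b) with
  | true => h ∘ seg (fact_d Y) k p
  | false => fmor T (h ∘ seg (fact_d Y) (inord 0) p) ∘
             (fact_dlast Y ∘ seg (fact_d Y) k (inord m))
  end.
have gp k : p = k -> fmor T (h ∘ seg (fact_d Y) (inord 0) p) ∘
    (fact_dlast Y ∘ seg (fact_d Y) k (inord m)) = w Q ∘ (h ∘ seg (fact_d Y) k p).
  move=> <-; rewrite fmor_comp -compA [X in _ ∘ X](fact_law Y p) -(natural w).
  by rewrite seg_id comp_idr.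
have gd (i : 'I_m) : g (inord i.+1) (@inord m i.+1 <= p)%N ∘ fact_d Y i
    = block_d i ∘ g (inord i) (@inord m i <= p)%N.
  have := leq_antitone (inord_step i); rewrite /block_d.
  case ep: (@inord m i <= p)%N; case eq: (@inord m i.+1 <= p)%N => //= _.
  - by rewrite comp_idl -compA -(seg_d (fact_d Y)) seg_comp // inord_step.
  - have e : p = inord i.
      apply/val_inj/anti_leq; rewrite /= ep andbT.
      by move/negbT: eq; rewrite !inordK ?ltnS // ?(ltnW (ltn_ord i)) // -ltnNge.
    rewrite -!compA -(seg_d (fact_d Y)) seg_comp ?inord_step ?le_inordm //.
    exact: gp.
  - rewrite -!compA -(seg_d (fact_d Y)) seg_comp ?inord_step ?le_inordm //.
    by rewrite comp_idl.
have gl : fmor T (g (inord 0) (@inord m 0 <= p)%N) ∘ fact_dlast Y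
    = block_last _ _ ∘ g (inord m) (@inord m m <= p)%N.
  rewrite inord0_le; case em: (@inord m m <= p)%N => /=.
    have e : p = inord m by apply/val_inj/anti_leq; rewrite /= em le_inordm.
    by rewrite -(comp_idr (fact_dlast Y)) -(seg_id (fact_d Y)) gp.
  by rewrite seg_id comp_idl comp_idr.
exists (@FactHom _ _ w m Y block (fun k => g k (k <= p)%N) gd gl); split.
  by rewrite /= /block_out leqnn /= seg_id comp_idl comp_idr.
move=> f fh; apply: fact_hom_eq => k /=.
have fnat (a b : 'I_m.+1) : (a <= b)%N ->
    f b ∘ seg (fact_d Y) a b = block_map (a <= p)%N (b <= p)%N ∘ f a.
  by move=> ab; rewrite (seg_natural (fact_map_d f) ab) seg_block.
have fp (a : 'I_m.+1) : (a <= p)%N ->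
    h ∘ seg (fact_d Y) a p = block_map (a <= p)%N true ∘ f a.
  move=> ap; rewrite -fh -compA fnat // compA; congr (comp _ (f a)).
  exact: (block_map_comp (c := true) (leq_antitone ap) (leqnn p)).
have e1 : (k <= p)%N -> g k true = block_map (k <= p)%N true ∘ f k.
  by move=> kp; rewrite /g fp.
have e2 : ~~ (k <= p)%N -> g k false = block_map (k <= p)%N false ∘ f k.
  move=> kp; have mpF : (@inord m m <= p)%N = false.
    by apply/negbTE; apply: contra kp; exact: leq_trans (le_inordm k).
  rewrite /g fp ?inord0_le // fmor_comp -compA (compA (fmor T (f _))).
  rewrite (fact_map_dlast f) -compA fnat ?le_inordm //=.
  by rewrite inord0_le mpF /= fmor_id !comp_idl.
move: (f k : hom (Y k) (block_ob (k <= p)%N)) e1 e2.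
by case: (k <= p)%N => x e1 e2; rewrite ?e1 ?e2 //= comp_idl.
Qed.

(** A map [g0] out of [T Q] at [p+1] determines the later components, and also
    a map [T Q -> T (Y 0)], which comes from a map [q : Q -> Y 0] because [T]
    is full; [q] determines the components up to [p].  The square at the step
    from [p] to [p+1] is checked after applying the faithful [T], where it
    becomes the naturality of [w] at [g0]. *)
Lemma block_free_after (j : 'I_m.+1) (jp : p.+1 = j :> nat) : is_equivalence T ->
  free_at (G := block) (j := j) (block_map false (j <= p)%N).
Proof.
move=> hT Y g0.
have jpF : (j <= p)%N = false by rewrite -jp ltnn.
have mpF : (@inord m m <= p)%N = false.
  by apply/negbTE; rewrite -ltnNge jp le_inordm.
have [q qE] := equiv_full hT
  (fact_dlast Y ∘ (seg (fact_d Y) j (inord m) ∘ g0)).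
pose g (k : 'I_m.+1) (b : bool) : hom (block_ob b) (Y k) :=
  match b return hom (block_ob b) (Y k) with
  | true => seg (fact_d Y) (inord 0) k ∘ q
  | false => seg (fact_d Y) j k ∘ g0
  end.
have gp k : j = k ->
    seg (fact_d Y) j k ∘ g0 ∘ w Q = seg (fact_d Y) (inord 0) k ∘ q.
  move=> <-; rewrite seg_id comp_idl; apply: (equiv_faithful hT).
  rewrite !fmor_comp qE -hw.
  have /= <- := natural w g0.
  by rewrite -fact_law /around !compA.
have gd (i : 'I_m) : g (inord i.+1) (@inord m i.+1 <= p)%N ∘ block_d i
    = fact_d Y i ∘ g (inord i) (@inord m i <= p)%N.
  have := leq_antitone (inord_step i); rewrite /block_d.
  case ep: (@inord m i <= p)%N; case eq: (@inord m i.+1 <= p)%N => //= _.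
  - rewrite comp_idr compA -(seg_d (fact_d Y)) seg_comp ?inord0_le //.
    exact: inord_step.
  - have e : j = inord i.+1.
      apply/val_inj/anti_leq; rewrite /= -jp (ltnNge p) eq /=.
      move: ep; rewrite !inordK ?ltnS //; exact: ltnW.
    rewrite gp // compA -(seg_d (fact_d Y)) seg_comp ?inord0_le //.
    exact: inord_step.
  - rewrite comp_idr compA -(seg_d (fact_d Y)) seg_comp ?inord_step //.
    by rewrite -jp ltnNge ep.
have gl : fmor T (g (inord 0) (@inord m 0 <= p)%N) ∘ block_last _ _
    = fact_dlast Y ∘ g (inord m) (@inord m m <= p)%N.
  by rewrite inord0_le mpF /= seg_id comp_idl comp_idr.
exists (@FactHom _ _ w m block Y (fun k => g k (k <= p)%N) gd gl); split.
  by rewrite /= jpF /= seg_id comp_idl comp_idr.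
move=> f fh; apply: fact_hom_eq => k /=.
have fnat (a b : 'I_m.+1) : (a <= b)%N ->
    f b ∘ block_map (a <= p)%N (b <= p)%N = seg (fact_d Y) a b ∘ f a.
  by move=> ab; rewrite -(seg_natural (fact_map_d f) ab) seg_block.
have fj (b : 'I_m.+1) : (j <= b)%N ->
    f b ∘ block_map false (b <= p)%N = seg (fact_d Y) j b ∘ g0.
  move=> jb; rewrite -fh compA -fnat // -compA block_map_comp //.
    by rewrite jpF.
  exact: leq_antitone.
have f0 : f (inord 0) ∘ block_map true (@inord m 0 <= p)%N = q.
  apply: (equiv_faithful hT); rewrite qE -fj ?le_inordm // compA.
  rewrite -(fact_map_dlast f) fmor_comp -compA; congr comp => /=.
  by rewrite inord0_le mpF /= fmor_id comp_idl.
have e1 : (k <= p)%N ->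
    g k true
    = comp (y := block_ob (k <= p)%N) (f k) (block_map true (k <= p)%N).
  move=> kp; rewrite /g -f0 compA -fnat ?inord0_le // -compA.
  congr (comp (f k) _).
  exact: (block_map_comp (a := true) (implybT _) (leq_antitone (inord0_le k))).
have e2 : ~~ (k <= p)%N ->
    g k false
    = comp (y := block_ob (k <= p)%N) (f k) (block_map false (k <= p)%N).
  by move=> kp; rewrite /g fj // -jp ltnNge.
move: (f k : hom (block_ob (k <= p)%N) (Y k)) e1 e2.
by case: (k <= p)%N => x e1 e2; rewrite ?e1 ?e2 //= comp_idr.
Qed.

(** For [p = m] the block is constantly [Q], and only its last map is [w Q]. *)
Lemma block_free_first : p = inord m ->
  free_at (G := block) (j := inord 0) (block_map true (@inord m 0 <= p)%N).
Proof.
move=> pm Y g0.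
have leP (k : 'I_m.+1) : (k <= p)%N by rewrite pm le_inordm.
pose g (k : 'I_m.+1) (b : bool) : hom (block_ob b) (Y k) :=
  match b return hom (block_ob b) (Y k) with
  | true => seg (fact_d Y) (inord 0) k ∘ g0
  | false => 0
  end.
have gd (i : 'I_m) : g (inord i.+1) (@inord m i.+1 <= p)%N ∘ block_d i
    = fact_d Y i ∘ g (inord i) (@inord m i <= p)%N.
  rewrite /block_d !leP /= comp_idr compA -(seg_d (fact_d Y)).
  rewrite seg_comp ?inord0_le //; exact: inord_step.
have gl : fmor T (g (inord 0) (@inord m 0 <= p)%N) ∘ block_last _ _
    = fact_dlast Y ∘ g (inord m) (@inord m m <= p)%N.
  rewrite !leP /= seg_id comp_idl.
  have /= <- := natural w g0.
  by rewrite -fact_law /around seg_id fmor_id comp_idl !compA.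
exists (@FactHom _ _ w m block Y (fun k => g k (k <= p)%N) gd gl); split.
  by rewrite /= leP /= seg_id comp_idl comp_idr.
move=> f fh; apply: fact_hom_eq => k /=.
have : seg (fact_d Y) (inord 0) k ∘ g0
    = comp (y := block_ob (k <= p)%N) (f k) (block_map true (k <= p)%N).
  rewrite -fh compA -(seg_natural (fact_map_d f)) ?inord0_le //.
  rewrite seg_block ?inord0_le // -compA block_map_comp ?implybT //.
  exact: leq_antitone (inord0_le k).
move: (leP k) (f k : hom (block_ob (k <= p)%N) (Y k)).
by case: (k <= p)%N => // _ x /= ->; rewrite comp_idr.
Qed.

End Block.

Arguments block_cofree {A T w} hw {m} p Q.
Arguments block_free_after {A T w} hw {m p} Q {j} jp hT.
Arguments block_free_first {A T w} hw {m p} Q pm.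

(** * Enough projective-injective factorizations *)

Section FactorizationFrobenius.
Variables (A : preaddCat) (E : pair_class A).
Hypothesis frE : is_Frobenius E.
Variable T : addFunctor A A.
Hypothesis hT : is_equivalence T.
Hypothesis hTE : exact_both_ways E T.
Variable w : natTrans (idFunctor A) T.
Hypothesis hw : forall X : A, w (T X) = fmor T (w X).
Variable m : nat.

Let exE : is_exact E. Proof. by case: frE. Qed.
Let projinj q : projective E q <-> injective_ob E q.
Proof. by case: frE. Qed.

Notation FE := (@fact_class A E T w m).

Lemma block_projinj p Q : projective E Q ->
  projective FE (block hw p Q) /\ injective_ob FE (block hw p Q).
Proof.
move=> pQ; split; last first.
  exact: (cofree_injective (block_cofree hw p Q)) ((projinj Q).1 pQ).
have [pm|pm] := eqVneq p (inord m).
  exact: (free_projective (block_free_first hw Q pm)) pQ.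
have pm' : (p < m)%N.
  rewrite ltn_neqAle -ltnS ltn_ord andbT.
  by apply: contra pm => /eqP pm; apply/eqP/val_inj; rewrite /= inordK.
have jp : p.+1 = @inord m p.+1 :> nat by rewrite inordK.
exact: (free_projective (block_free_after hw Q jp hT))
  (equiv_projective hT exE hTE pQ).
Qed.

Lemma deflation_cancel_iso (x y z : A) (u : hom x y) (p : hom y z) (e : hom x z) :
  is_iso u -> p ∘ u = e -> deflation E e -> deflation E p.
Proof.
case=> v [vu uv] pu de.
rewrite -(comp_idr p) -uv compA pu; apply: deflation_comp_iso => //.
by exists u.
Qed.

Lemma inflation_cancel_iso (x y z : A) (v : hom y z) (l : hom x y) (e : hom x z) :
  is_iso v -> v ∘ l = e -> inflation E e -> inflation E l.
Proof.
case=> u [uv vu] vl de.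
rewrite -(comp_idl l) -uv -compA vl; apply: inflation_iso_comp => //.
by exists v.
Qed.

(** Start from a deflation onto [X j] from a projective [P].  For [j > 0] the
    object [P] has to be written as [T Q] up to isomorphism before it generates
    a block; [Q] is projective because [T] reflects projectives. *)
Lemma deflation_from_projinj (X : factCat w m) j :
  exists (G : factCat w m) (g : hom G X),
    [/\ projective FE G, injective_ob FE G & deflation E (fact_map g j)].
Proof.
have [_ EP _ _] := frE; have [P [e [pP de]]] := EP (fact_ob X j).
have [j0|j_gt0] := posnP j.
  have {}j0 : j = inord 0 by apply: val_inj; rewrite /= inordK.
  subst j; have [g [ge _]] := block_free_first hw P (erefl (inord m)) _ e.
  have [pG iG] := block_projinj (inord m) pP.
  exists (block hw (inord m) P), g; split=> //.
  by apply: deflation_cancel_iso ge de; rewrite /= inord0_le; exact: is_iso_id.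
have [Q [a [b [ba ab]]]] := equiv_ess_surj hT P.
have pTQ : projective E (T Q) by apply: projective_retract ba pP.
have pQ := equiv_projective_reflect hT hTE pTQ.
pose p : 'I_m.+1 := inord j.-1.
have jp : p.+1 = j :> nat.
  by rewrite inordK ?prednK // ltnW.
have [g [ge _]] := block_free_after hw Q jp hT _ (e ∘ a).
have [pG iG] := block_projinj p pQ.
exists (block hw p Q), g; split=> //.
apply: deflation_cancel_iso ge _; first by rewrite /= -jp ltnn; exact: is_iso_id.
by apply: deflation_comp_iso => //; exists b.
Qed.

Lemma inflation_to_projinj (X : factCat w m) j :
  exists (G : factCat w m) (g : hom X G),
    [/\ projective FE G, injective_ob FE G & inflation E (fact_map g j)].
Proof.
have [_ _ EI _] := frE; have [Q [e [jQ de]]] := EI (fact_ob X j).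
have [g [ge _]] := block_cofree hw j Q _ e.
have [pG iG] := block_projinj j ((projinj Q).2 jQ).
exists (block hw j Q), g; split=> //.
by apply: inflation_cancel_iso ge de; rewrite /block_out /= leqnn; exact: is_iso_id.
Qed.

Lemma biproduct_at (X Y S : factCat w m) (i1 : hom X S) (i2 : hom Y S)
    (p1 : hom S X) (p2 : hom S Y) j :
  is_biproduct i1 i2 p1 p2 ->
  is_biproduct (fact_map i1 j) (fact_map i2 j) (fact_map p1 j) (fact_map p2 j).
Proof.
case=> e1 e2 e3 e4 e5; split.
- exact: fact_map_congr j e1.
- exact: fact_map_congr j e2.
- exact: fact_map_congr j e3.
- exact: fact_map_congr j e4.
- exact: fact_map_congr j e5.
Qed.

(** Adding one block per position, by induction on the number [n] of positions
    served; a summand that is a deflation at [j] makes the sum one. *)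
Lemma enough_projinj_deflation (X : factCat w m) :
  exists (G : factCat w m) (g : hom G X),
    [/\ projective FE G, injective_ob FE G & deflation FE g].
Proof.
have exF : is_exact FE := fact_exact w m exE hT.
suff /(_ m.+1) [G [g [pG iG dg]]] : forall n, exists (G : factCat w m)
    (g : hom G X), [/\ projective FE G, injective_ob FE G
      & forall j : 'I_m.+1, (j < n)%N -> deflation E (fact_map g j)].
  by exists G, g; split=> //; apply: (deflation_componentwise exE hT) => j;
    exact: dg.
elim=> [|n [G [g [pG iG dg]]]].
  have [Z Z0] := (exact_additive exF).1; exists Z, 0; split=> // Y Y' f h _.
    by exists 0; rewrite comp0r [RHS](zero_ob_from _ Z0).
  by exists 0; rewrite comp0l [RHS](zero_ob_to _ Z0).
have [G' [g' [pG' iG' dg']]] := deflation_from_projinj X (inord n).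
have [S [i1 [i2 [p1 [p2 bs]]]]] := (exact_additive exF).2 G G'.
exists S, (g ∘ p1 + g' ∘ p2); split.
- exact: projective_biproduct bs pG pG'.
- exact: injective_biproduct bs iG iG'.
move=> j; rewrite ltnS leq_eqVlt => /orP[/eqP jn|jn].
  have {dg'} dj : deflation E (fact_map g' j) by move: dg'; rewrite -jn inord_val.
  have := deflation_copair exE (fact_map g j) (biproductC (biproduct_at j bs)) dj.
  by rewrite addrC.
have := deflation_copair exE (fact_map g' j) (biproduct_at j bs) (dg j jn); exact.
Qed.

Lemma enough_projinj_inflation (X : factCat w m) :
  exists (G : factCat w m) (g : hom X G),
    [/\ projective FE G, injective_ob FE G & inflation FE g].
Proof.
have exF : is_exact FE := fact_exact w m exE hT.
suff /(_ m.+1) [G [g [pG iG dg]]] : forall n, exists (G : factCat w m)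
    (g : hom X G), [/\ projective FE G, injective_ob FE G
      & forall j : 'I_m.+1, (j < n)%N -> inflation E (fact_map g j)].
  by exists G, g; split=> //; apply: (inflation_componentwise exE) => j;
    exact: dg.
elim=> [|n [G [g [pG iG dg]]]].
  have [Z Z0] := (exact_additive exF).1; exists Z, 0; split=> // Y Y' f h _.
    by exists 0; rewrite comp0r [RHS](zero_ob_from _ Z0).
  by exists 0; rewrite comp0l [RHS](zero_ob_to _ Z0).
have [G' [g' [pG' iG' dg']]] := inflation_to_projinj X (inord n).
have [S [i1 [i2 [p1 [p2 bs]]]]] := (exact_additive exF).2 G G'.
exists S, (i1 ∘ g + i2 ∘ g'); split.
- exact: projective_biproduct bs pG pG'.
- exact: injective_biproduct bs iG iG'.
move=> j; rewrite ltnS leq_eqVlt => /orP[/eqP jn|jn].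
  have {dg'} dj : inflation E (fact_map g' j) by move: dg'; rewrite -jn inord_val.
  have := inflation_pair (fact_map g j) exE (biproductC (biproduct_at j bs)) dj.
  by rewrite addrC.
have := inflation_pair (fact_map g' j) exE (biproduct_at j bs) (dg j jn); exact.
Qed.

Lemma fact_Frobenius : is_Frobenius FE.
Proof.
apply: Frobenius_of_projinj; first exact: fact_exact.
- exact: enough_projinj_deflation.
- exact: enough_projinj_inflation.
Qed.

End FactorizationFrobenius.

Local Close Scope cat_scope.
Local Close Scope ring_scope.

Theorem theorem4p9 (n : nat) (hn : 2 <= n)
  (A : preaddCat) (E : pair_class A) (hE : is_Frobenius E)
  (T : addFunctor A A) (hT : is_equivalence T) (hTE : exact_both_ways E T)
  (w : natTrans (idFunctor A) T)
  (hw : forall X : A, w (T X) = fmor T (w X)) :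
  is_Frobenius (Fact_class (n := n) (w := w) E).
Proof. exact: (fact_Frobenius hE hT hTE hw n.-1). Qed.
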